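(* The following statements hold. (i) A ring $R$ is left virtually semisimple if and only if every free left $R$-module is virtually semisimple; and a ring $R$ is left completely virtually semisimple if and only if every projective left $R$-module is completely virtually semisimple. (ii) Let $R$ be a ring Morita equivalent to a ring $S$. Then $R$ is left completely virtually semisimple if and only if $S$ is left completely virtually semisimple. (iii) The class of left virtually semisimple rings is closed under finite direct products, and so is the class of left completely virtually semisimple rings. (iv) Let $R$ be a left completely virtually semisimple ring. Then for any semisimple left $R$-module $N$ and any projective left $R$-module $P$ with $\mathrm{Soc}({}_RP)=0$, the module $N\oplus P$ is a completely virtually semisimple $R$-module.
   Context: All rings are associative with identity (not necessarily commutative) and all modules are unitary left modules. A module $M$ is virtually semisimple if each submodule of $M$ is isomorphic to a direct summand of $M$. It is completely virtually semisimple if each submodule of $M$ is a virtually semisimple module. A ring $R$ is left virtually semisimple (resp. left completely virtually semisimple) if the left module ${}_RR$ is virtually semisimple (resp. completely virtually semisimple). $\mathrm{Soc}({}_RP)$ is the socle of $P$, the sum of all simple submodules of $P$. *)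

(* Defs.v *)
From HB Require Import structures.
From mathcomp Require Import all_boot all_algebra.

Set Implicit Arguments.
Unset Strict Implicit.
Unset Printing Implicit Defensive.

Import GRing.Theory.
Local Open Scope ring_scope.

(* Rings are [pzRingType]s: associative, unital, not necessarily commutative,
   and the zero ring is allowed.  An [lmodType R] is a unitary left R-module.
   Submodules of M are [submodClosed M], i.e. boolean predicates closed under
   the module operations; under classical logic these are all the submodules. *)

(* [submodClosed] structures are predicates; this is the associated module. *)
Definition submodule (R : pzRingType) (M : lmodType R) (N : submodClosed M) :=
  {x : M | x \in N}.

HB.instance Definition _ (R : pzRingType) (M : lmodType R)
  (N : submodClosed M) := SubChoice.on (submodule N).
HB.instance Definition _ (R : pzRingType) (M : lmodType R)
  (N : submodClosed M) := [SubChoice_isSubLmodule of submodule N by <:].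

Definition isomorphic (R : pzRingType) (M N : lmodType R) : Prop :=
  exists f : {linear M -> N}, bijective f.

(* M is the internal direct sum of D and some submodule D'. *)
Definition direct_summand (R : pzRingType) (M : lmodType R)
    (D : submodClosed M) : Prop :=
  exists D' : submodClosed M,
    (forall x : M, exists u v : M, [/\ u \in D, v \in D' & x = u + v]) /\
    (forall x : M, x \in D -> x \in D' -> x = 0).

Definition virtually_semisimple (R : pzRingType) (M : lmodType R) : Prop :=
  forall N : submodClosed M, exists D : submodClosed M,
    direct_summand D /\ isomorphic (submodule N) (submodule D).

Definition completely_virtually_semisimple (R : pzRingType) (M : lmodType R)
    : Prop :=
  forall N : submodClosed M, virtually_semisimple (submodule N).

Definition left_virtually_semisimple (R : pzRingType) : Prop :=
  virtually_semisimple (R^o : lmodType R).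

Definition left_completely_virtually_semisimple (R : pzRingType) : Prop :=
  completely_virtually_semisimple (R^o : lmodType R).

Definition linearly_independent (R : pzRingType) (M : lmodType R)
    (B : {pred M}) : Prop :=
  forall (s : seq M) (a : M -> R), uniq s -> {subset s <= B} ->
    \sum_(x <- s) a x *: x = 0 -> forall x, x \in s -> a x = 0.

Definition generates (R : pzRingType) (M : lmodType R) (B : {pred M}) : Prop :=
  forall x : M, exists (s : seq M) (a : M -> R),
    {subset s <= B} /\ x = \sum_(y <- s) a y *: y.

Definition free_module (R : pzRingType) (M : lmodType R) : Prop :=
  exists B : {pred M}, linearly_independent B /\ generates B.

Definition projective (R : pzRingType) (P : lmodType R) : Prop :=
  forall (M N : lmodType R) (g : {linear M -> N}) (f : {linear P -> N}),
    (forall y : N, exists x : M, g x = y) ->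
    exists h : {linear P -> M}, forall x : P, g (h x) = f x.

Definition simple_module (R : pzRingType) (M : lmodType R) : Prop :=
  (exists x : M, x != 0) /\
  forall N : submodClosed M,
    (forall x : M, x \in N -> x = 0) \/ (forall x : M, x \in N).

(* Membership in the sum of all simple submodules of M; the empty sum gives 0. *)
Definition in_socle (R : pzRingType) (M : lmodType R) (x : M) : Prop :=
  exists s : seq M,
    (forall y : M, y \in s ->
       exists S : submodClosed M, simple_module (submodule S) /\ y \in S) /\
    x = \sum_(y <- s) y.

Definition semisimple_module (R : pzRingType) (M : lmodType R) : Prop :=
  forall x : M, in_socle x.

Definition socle_eq0 (R : pzRingType) (M : lmodType R) : Prop :=
  forall x : M, in_socle x -> x = 0.

(* Functors between categories of left modules; morphisms are linear maps
   compared pointwise, whence the extensionality field. *)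
Record module_functor (R S : pzRingType) := ModuleFunctor {
  fobj :> lmodType R -> lmodType S;
  fmap : forall M N : lmodType R, {linear M -> N} -> {linear fobj M -> fobj N};
  fmap_ext : forall (M N : lmodType R) (f g : {linear M -> N}),
    f =1 g -> fmap f =1 fmap g;
  fmap_id : forall M : lmodType R, fmap (idfun : {linear M -> M}) =1 id;
  fmap_comp : forall (L M N : lmodType R) (g : {linear M -> N})
    (f : {linear L -> M}),
    fmap (g \o f : {linear L -> N}) =1 fmap g \o fmap f
}.

(* The composite G o F is naturally isomorphic to the identity functor. *)
Definition comp_natural_iso_id (R S : pzRingType) (F : module_functor R S)
    (G : module_functor S R) : Prop :=
  exists eta : forall M : lmodType R, {linear M -> G (F M)},
    (forall M : lmodType R, bijective (eta M)) /\
    (forall (M N : lmodType R) (f : {linear M -> N}) (x : M),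
       eta N (f x) = fmap G (fmap F f) (eta M x)).

(* The categories of left modules are equivalent.  Additivity of the functors
   is not required: it is automatic for an equivalence. *)
Definition morita_equivalent (R S : pzRingType) : Prop :=
  exists (F : module_functor R S) (G : module_functor S R),
    comp_natural_iso_id F G /\ comp_natural_iso_id G F.

(* The direct product of a finite family of rings, with componentwise
   operations; MathComp only has the constant-family case {ffun I -> R}. *)
Definition ring_prod (I : finType) (R : I -> pzRingType) :=
  {dffun forall i : I, R i}.

Section RingProd.
Variables (I : finType) (R : I -> pzRingType).
Implicit Types x y z : ring_prod R.

HB.instance Definition _ := Choice.on (ring_prod R).

Definition rp_zero : ring_prod R := [ffun i => 0 : R i].
Definition rp_opp x : ring_prod R := [ffun i => - x i].
Definition rp_add x y : ring_prod R := [ffun i => x i + y i].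
Definition rp_one : ring_prod R := [ffun i => 1 : R i].
Definition rp_mul x y : ring_prod R := [ffun i => x i * y i].

Fact rp_addA : associative rp_add.
Proof. by move=> x y z; apply/ffunP => i; rewrite !ffunE addrA. Qed.
Fact rp_addC : commutative rp_add.
Proof. by move=> x y; apply/ffunP => i; rewrite !ffunE addrC. Qed.
Fact rp_add0 : left_id rp_zero rp_add.
Proof. by move=> x; apply/ffunP => i; rewrite !ffunE add0r. Qed.
Fact rp_addN : left_inverse rp_zero rp_opp rp_add.
Proof. by move=> x; apply/ffunP => i; rewrite !ffunE addNr. Qed.

HB.instance Definition _ :=
  GRing.isZmodule.Build (ring_prod R) rp_addA rp_addC rp_add0 rp_addN.

Fact rp_mulA : associative rp_mul.
Proof. by move=> x y z; apply/ffunP => i; rewrite !ffunE mulrA. Qed.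
Fact rp_mul1 : left_id rp_one rp_mul.
Proof. by move=> x; apply/ffunP => i; rewrite !ffunE mul1r. Qed.
Fact rp_mulr1 : right_id rp_one rp_mul.
Proof. by move=> x; apply/ffunP => i; rewrite !ffunE mulr1. Qed.
Fact rp_mulDl : left_distributive rp_mul rp_add.
Proof. by move=> x y z; apply/ffunP => i; rewrite !ffunE mulrDl. Qed.
Fact rp_mulDr : right_distributive rp_mul rp_add.
Proof. by move=> x y z; apply/ffunP => i; rewrite !ffunE mulrDr. Qed.

HB.instance Definition _ :=
  GRing.Zmodule_isPzRing.Build (ring_prod R)
    rp_mulA rp_mul1 rp_mulr1 rp_mulDl rp_mulDr.
End RingProd.

(* Main.v *)
From HB Require Import structures.
Require Import Defs.
From mathcomp Require Import all_boot all_algebra.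
From mathcomp Require Import boolp classical_sets functions wochoice.

Set Implicit Arguments.
Unset Strict Implicit.
Unset Printing Implicit Defensive.

Import GRing.Theory.
Local Open Scope ring_scope.

(** Everything is phrased with maps.  Say that K is a retract of M when some
    linear K -> M has a linear left inverse.  Then M is virtually semisimple
    iff every module that embeds in M is a retract of M ([vssP]), and it is
    completely so iff every module that embeds in M is virtually semisimple
    ([cvssP]).  These two forms make no reference to an ambient module, so they
    pass to isomorphic modules and are transported by functors.

    The heart of the matter is a version of Kaplansky's theorem on hereditary
    rings.  Well-order the basis I of a free module F.  For a submodule N of F,
    let J_t be the left ideal of the coefficients at t of the elements of N
    whose support is bounded by t.  If R is left virtually semisimple, J_t is
    isomorphic to a summand R g_t of R, with g_t idempotent: J_t = R c_t and
    x |-> x c_t is injective on R g_t ([vss_cyclic]).  Lifting each c_t to an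
    element m_t of N bounded by t gives a triangular family, and f |-> sum of
    the f_t m_t is an isomorphism from the direct sum of the R g_t, denoted
    [dsum g], onto N ([dsum_iso]).  If N lies in [dsum e] and the R e_t are
    virtually semisimple, the g_t can be taken in R e_t, whence [dsum g] is a
    retract of [dsum e]; so a direct sum of virtually semisimple ideals R e_t is
    virtually semisimple ([vss_dsum]).  With e = 1 this settles free modules.
    If R is completely virtually semisimple, each submodule of F is such a
    direct sum, hence F, and every projective module as a submodule of some F,
    is completely virtually semisimple.

    Morita invariance follows: an equivalence of module categories preserves
    injective maps, surjective maps, projective modules and retracts, so a
    failure over S inside the projective module S would be reflected over R.

    A left ideal of a finite product of rings is the product of its
    projections, so retractions can be built componentwise.

    Finally, if every submodule of P is projective, a submodule K of N * P is
    isomorphic to the product of a submodule of N and a submodule of P: the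
    projection of K to P has projective image and splits ([pair_embeds]).
    Hence N * P is completely virtually semisimple when N and P are.  Semisimple
    modules are, because Zorn's lemma gives every submodule a complement, and
    projective modules are by the above. *)

(** * Submodules given by propositions and linear maps given by graphs *)

Section Builders.
Variables (R : pzRingType) (M N : lmodType R).

Definition mk_linear (f : M -> N) (lf : linear f) : {linear M -> N}.
Proof. exact: (HB.pack f (GRing.isLinear.Build R M N *:%R f lf)). Defined.

Variable P : M -> Prop.
Hypothesis (P0 : P 0) (PD : forall a x y, P x -> P y -> P (a *: x + y)).

Lemma asbool_submod_closed : submod_closed (fun x => `[< P x >]).
Proof.
split; first exact/asboolP.
by move=> a x y /asboolP Px /asboolP Py; apply/asboolP/PD.
Qed.

Definition mk_submod : submodClosed M.
Proof.
exact: (HB.pack (fun x => `[< P x >])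
  (GRing.isSubmodClosed.Build R M _ asbool_submod_closed)).
Defined.

Lemma mk_submodP x : reflect (P x) (x \in mk_submod).
Proof. exact: asboolP. Qed.
End Builders.

Lemma submodN (R : pzRingType) (M : lmodType R) (N : submodClosed M) x :
  (- x \in N) = (x \in N).
Proof.
by apply/idP/idP => /(rpredZ (-1)); rewrite scaleN1r // opprK.
Qed.

Section Sub.
Variables (R : pzRingType) (M K : lmodType R) (N : submodClosed M).

Definition incl : {linear submodule N -> M} :=
  mk_linear (linearP (\val : submodule N -> M)).

Lemma incl_inj : injective incl.
Proof. exact: val_inj. Qed.

Lemma incl_in x : incl x \in N.
Proof. exact: valP. Qed.

Lemma inclP x : x \in N -> exists y, x = incl y.
Proof. by move=> Nx; exists (Sub x Nx). Qed.

Lemma corestr_subproof (f : {linear K -> M}) (fN : forall x, f x \in N) :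
  linear (fun x => Sub (f x) (fN x) : submodule N).
Proof. by move=> a x y; exact/val_inj/(linearP f). Qed.

Definition corestr f fN := mk_linear (@corestr_subproof f fN).

Lemma corestrE f fN x : incl (@corestr f fN x) = f x.
Proof. by []. Qed.
End Sub.

Lemma linear_inj (R : pzRingType) (M N : lmodType R) (f : {linear M -> N}) :
  (forall x, f x = 0 -> x = 0) -> injective f.
Proof.
move=> f0 x y fxy; apply/eqP; rewrite -subr_eq0; apply/eqP/f0.
by rewrite linearB fxy subrr.
Qed.

(** Most of the maps below (inverses, projections along a complement, maps out
    of free modules) are easy to describe by a relation and awkward to define;
    this lemma discharges functionality and linearity together, since a linear
    relation is single-valued as soon as it is so at 0. *)
Lemma linear_graph (R : pzRingType) (M N : lmodType R) (G : M -> N -> Prop) :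
  (forall x, exists y, G x y) ->
  (forall a x y x' y', G x x' -> G y y' -> G (a *: x + y) (a *: x' + y')) ->
  (forall y, G 0 y -> y = 0) ->
  exists f : {linear M -> N}, forall x, G x (f x).
Proof.
move=> /choice[f Gf] Glin G0.
suff lf : linear f by exists (mk_linear lf).
move=> a x y; have Gxy := Glin a _ _ _ _ (Gf x) (Gf y).
have := Glin (-1) _ _ _ _ (Gf (a *: x + y)) Gxy.
by rewrite !scaleN1r addNr => /G0/eqP; rewrite addr_eq0 eqr_opp => /eqP.
Qed.

Lemma inj_surj_inv (R : pzRingType) (M N : lmodType R) (f : {linear M -> N}) :
  injective f -> (forall y, exists x, f x = y) ->
  exists g : {linear N -> M}, cancel f g /\ cancel g f.
Proof.
move=> fI fS.
have [||g fg] := linear_graph (G := fun y x => f x = y) fS.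
- by move=> a x y x' y' <- <-; rewrite linearP.
- by move=> y fy0; apply: fI; rewrite fy0 linear0.
by exists g; split=> // x; apply: fI; rewrite fg.
Qed.

Lemma bij_linear_inv (R : pzRingType) (M N : lmodType R) (f : {linear M -> N}) :
  bijective f -> exists g : {linear N -> M}, cancel f g /\ cancel g f.
Proof.
move=> fB; apply: inj_surj_inv; first exact: bij_inj.
by case: fB => g _ gK y; exists (g y).
Qed.

Section ImageKernel.
Variables (R : pzRingType) (M N : lmodType R) (f : {linear M -> N}).

Lemma image_sub0 : exists y, 0 = f y.
Proof. by exists 0; rewrite linear0. Qed.

Lemma image_subD a x y :
  (exists u, x = f u) -> (exists u, y = f u) -> exists u, a *: x + y = f u.
Proof. by case=> [u ->] [v ->]; exists (a *: u + v); rewrite linearP. Qed.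

Definition image_sub := mk_submod image_sub0 image_subD.

Lemma image_subP x : reflect (exists y, x = f y) (x \in image_sub).
Proof. exact: mk_submodP. Qed.

Lemma kernel_subD a x y : f x = 0 -> f y = 0 -> f (a *: x + y) = 0.
Proof. by move=> fx fy; rewrite linearP fx fy scaler0 addr0. Qed.

Definition kernel_sub := mk_submod (linear0 f) kernel_subD.

Lemma kernel_subP x : reflect (f x = 0) (x \in kernel_sub).
Proof. exact: mk_submodP. Qed.

Lemma image_sub_in x : f x \in image_sub.
Proof. by apply/image_subP; exists x. Qed.

Definition to_image_sub := corestr image_sub_in.

Lemma to_image_sub_surj y : exists x, to_image_sub x = y.
Proof.
have /image_subP[x xE] := incl_in y.
by exists x; apply: incl_inj; rewrite corestrE.
Qed.

Lemma to_image_sub_inv : injective f ->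
  exists g : {linear submodule image_sub -> M},
    cancel to_image_sub g /\ cancel g to_image_sub.
Proof.
move=> fI; apply: inj_surj_inv; last exact: to_image_sub_surj.
by move=> x y /(congr1 (incl _)); rewrite !corestrE => /fI.
Qed.
End ImageKernel.

(** * Virtual semisimplicity in terms of embeddings and retracts *)

(** The splitting is the projection along D, followed by the inverse of i. *)
Lemma split_of_complement (R : pzRingType) (K M : lmodType R)
    (i : {linear K -> M}) (D : submodClosed M) :
  (forall x, exists y, x - i y \in D) -> (forall y, i y \in D -> y = 0) ->
  exists p : {linear M -> K}, cancel i p.
Proof.
move=> dec dis.
have [||p pP] := linear_graph (G := fun x y => x - i y \in D) dec.
- move=> a x y x' y' xD yD; rewrite linearP opprD addrACA -scalerBr.
  by rewrite rpredD // rpredZ.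
- by move=> y; rewrite sub0r submodN => /dis.
exists p => y; apply/esym/eqP; rewrite -subr_eq0; apply/eqP/dis.
by rewrite linearB; exact: pP.
Qed.

Section Retracts.
Variable R : pzRingType.
Implicit Types K M N : lmodType R.

Definition embeds K M := exists k : {linear K -> M}, injective k.
Definition retract K M :=
  exists (i : {linear K -> M}) (p : {linear M -> K}), cancel i p.

Lemma embeds_trans M K N : embeds K M -> embeds M N -> embeds K N.
Proof. by case=> f fI [g gI]; exists (g \o f); exact: inj_comp. Qed.

Lemma retract_embeds K M : retract K M -> embeds K M.
Proof. by case=> i [p ip]; exists i; exact: can_inj ip. Qed.

Lemma retract_trans M K N : retract K M -> retract M N -> retract K N.
Proof.
case=> i [p ip] [j [q jq]]; exists (j \o i), (p \o q).
exact: (can_comp jq ip).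
Qed.

Lemma sub_embeds M (N : submodClosed M) : embeds (submodule N) M.
Proof. by exists (incl N); exact: incl_inj. Qed.

(** An embedding k of K and an isomorphism of its image onto a direct summand
    compose to an embedding i onto that summand, which splits; i is in general
    different from k.  Conversely a retraction p of i makes the kernel of p a
    complement of the image of i. *)
Lemma vssP M :
  virtually_semisimple M <-> forall K, embeds K M -> retract K M.
Proof.
split=> [vM K [k kI] | rM N].
  have [D [[D' [dec dis]] [phi phiB]]] := vM (image_sub k).
  pose i : {linear K -> M} := incl D \o (phi \o to_image_sub k).
  have iD y : i y \in D by exact: incl_in.
  have iI : injective i.
    apply: inj_comp; first exact: incl_inj.
    apply: inj_comp; first exact: bij_inj.
    by move=> x y /(congr1 (incl _)); rewrite !corestrE => /kI.
  have iS x : x \in D -> exists y, x = i y.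
    case/inclP=> u ->; case: phiB => psi _ psiK.
    have [y yE] := to_image_sub_surj (psi u).
    by exists y; rewrite -(psiK u) -yE.
  have [||p ip] := @split_of_complement R K M i D'; last by exists i, p.
    move=> x; have [u [v [uD vD' ->]]] := dec x.
    by have [y ->] := iS u uD; exists y; rewrite addrC addKr.
  by move=> y /(dis _ (iD y)) iy0; apply: iI; rewrite iy0 linear0.
have [i [p ip]] := rM (submodule N) (sub_embeds N).
exists (image_sub i); split.
  exists (kernel_sub p); split.
    move=> x; exists (i (p x)), (x - i (p x)); split.
    - exact: image_sub_in.
    - by apply/kernel_subP; rewrite linearB ip subrr.
    - by rewrite addrC subrK.
  by move=> x /image_subP[y ->] /kernel_subP; rewrite ip => ->; rewrite linear0.
have [g [fg gf]] := to_image_sub_inv (can_inj ip).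
by exists (to_image_sub i), g.
Qed.

Lemma vss_retract M N : retract M N -> retract N M ->
  virtually_semisimple M -> virtually_semisimple N.
Proof.
move=> MN NM /vssP vM; apply/vssP => K KN.
apply: retract_trans MN; apply: vM; exact/(embeds_trans KN)/retract_embeds.
Qed.

Lemma cvssP M : completely_virtually_semisimple M <->
  forall N, embeds N M -> virtually_semisimple N.
Proof.
split=> [cM N [k kI] | cM N]; last exact/cM/sub_embeds.
have [g [fg gf]] := to_image_sub_inv kI.
apply: (vss_retract _ _ (cM (image_sub k))).
  by exists g, (to_image_sub k).
by exists (to_image_sub k), g.
Qed.

Lemma cvss_embeds M N : embeds N M ->
  completely_virtually_semisimple M -> completely_virtually_semisimple N.
Proof.
by move=> NM /cvssP cM; apply/cvssP => K /embeds_trans/(_ NM)/cM.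
Qed.

Lemma cvss_vss M : completely_virtually_semisimple M -> virtually_semisimple M.
Proof. by move/cvssP; apply; exists idfun. Qed.
End Retracts.

Section Isomorphic.
Variable R : pzRingType.
Implicit Types M N : lmodType R.

Lemma isomorphic_sym M N : isomorphic M N -> isomorphic N M.
Proof. by case=> f /bij_linear_inv[g [fg gf]]; exists g, f. Qed.

Lemma isomorphic_retract M N : isomorphic M N -> retract M N.
Proof. by case=> f /bij_linear_inv[g [fg _]]; exists f, g. Qed.

Lemma isomorphic_trans M N K :
  isomorphic M N -> isomorphic N K -> isomorphic M K.
Proof. by case=> f fB [g gB]; exists (g \o f); exact: bij_comp. Qed.

Lemma image_sub_iso M N (f : {linear M -> N}) :
  injective f -> isomorphic M (submodule (image_sub f)).
Proof. by case/to_image_sub_inv=> g [fg gf]; exists (to_image_sub f), g. Qed.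

Lemma full_iso M (N : submodClosed M) :
  (forall x, x \in N) -> isomorphic (submodule N) M.
Proof.
move=> NT; exists (incl N).
have [|y|g [fg gf]] := inj_surj_inv (f := incl N); last by exists g.
- exact: incl_inj.
- by have /inclP[x ->] := NT y; exists x.
Qed.

Lemma vss_isomorphic M N : isomorphic M N ->
  virtually_semisimple M -> virtually_semisimple N.
Proof.
move=> MN; apply: vss_retract; apply: isomorphic_retract => //.
exact: isomorphic_sym.
Qed.
End Isomorphic.

(** * The free module on a type *)

Section FreeModule.
Variables (R : pzRingType) (I : choiceType).

Lemma fsupp0 : exists s : seq I, forall i, i \notin s -> (0 : I -> R^o) i = 0.
Proof. by exists [::]. Qed.

Lemma fsuppD (a : R) (x y : I -> R^o) :
  (exists s : seq I, forall i, i \notin s -> x i = 0) ->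
  (exists s : seq I, forall i, i \notin s -> y i = 0) ->
  exists s : seq I, forall i, i \notin s -> (a *: x + y) i = 0.
Proof.
move=> [s sx] [t ty]; exists (s ++ t) => i; rewrite mem_cat negb_or.
by case/andP=> /sx xi /ty yi; rewrite !fctE xi yi scaler0 addr0.
Qed.

Definition fsupp : submodClosed (I -> R^o) := mk_submod fsupp0 fsuppD.

Definition free_mod : lmodType R := submodule fsupp.

Definition coef (x : free_mod) (i : I) : R := incl fsupp x i.

Lemma coefP a x y i : coef (a *: x + y) i = a * coef x i + coef y i.
Proof. by rewrite /coef linearP. Qed.

Lemma coef0 i : coef 0 i = 0.
Proof. by rewrite /coef linear0. Qed.

Lemma coefZ a x i : coef (a *: x) i = a * coef x i.
Proof. by rewrite -[a *: x]addr0 coefP coef0 addr0. Qed.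

Lemma coef_sum (J : Type) (s : seq J) (P : pred J) (F : J -> free_mod) i :
  coef (\sum_(j <- s | P j) F j) i = \sum_(j <- s | P j) coef (F j) i.
Proof.
apply: (big_morph (coef^~ i)) => [x y|]; last exact: coef0.
by rewrite /coef linearD.
Qed.

Lemma free_ext (x y : free_mod) : (forall i, coef x i = coef y i) -> x = y.
Proof. by move=> xy; apply/incl_inj/funext => i; apply: xy. Qed.

Lemma free_build (f : I -> R) (s : seq I) : (forall i, i \notin s -> f i = 0) ->
  exists x : free_mod, forall i, coef x i = f i.
Proof.
move=> fs; have /inclP[x xE] : (f : I -> R^o) \in fsupp.
  by apply/mk_submodP; exists s.
by exists x => i; rewrite xE.
Qed.

Lemma free_supp (x : free_mod) :
  exists2 s : seq I, uniq s & forall i, i \notin s -> coef x i = 0.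
Proof.
have /mk_submodP[s sx] := incl_in x.
exists (undup s); first exact: undup_uniq.
by move=> i; rewrite mem_undup; apply: sx.
Qed.

Lemma basis_vec_ex i : exists x : free_mod, forall j, coef x j = (j == i)%:R.
Proof. by apply: (@free_build _ [:: i]) => j; rewrite inE => /negPf->. Qed.

Definition basis_vec i : free_mod := projT1 (cid (basis_vec_ex i)).

Lemma coef_basis_vec i j : coef (basis_vec i) j = (j == i)%:R.
Proof. exact: (projT2 (cid (basis_vec_ex i))). Qed.

Lemma free_sum (x : free_mod) (s : seq I) :
  uniq s -> (forall i, i \notin s -> coef x i = 0) ->
  x = \sum_(i <- s) coef x i *: basis_vec i.
Proof.
move=> us sx; apply: free_ext => j; rewrite coef_sum.
under eq_bigr => i _ do rewrite coefZ coef_basis_vec.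
have [js|js] := boolP (j \in s); last first.
  rewrite sx // big_seq big1 // => i si.
  by case: eqP => [ji|_]; [rewrite ji si in js | rewrite mulr0].
rewrite (bigD1_seq j) //= eqxx big1 ?addr0 => [|i /negPf ij].
  by rewrite mulr1.
by rewrite eq_sym ij mulr0.
Qed.

(** The value at x is the sum of [coef x i *: m i] over any finite set that
    contains the support of x; the relation used quantifies over such sets, and
    [SE] says that they all give the same sum. *)
Lemma free_lift (M : lmodType R) (m : I -> M) :
  exists f : {linear free_mod -> M}, forall i, f (basis_vec i) = m i.
Proof.
pose S (s : seq I) (x : free_mod) := \sum_(i <- s) coef x i *: m i.
have SE s t x : uniq s -> uniq t -> (forall i, i \notin s -> coef x i = 0) ->
    (forall i, i \notin t -> coef x i = 0) -> S s x = S t x.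
  move=> us ut sx tx; rewrite /S.
  rewrite (bigID (mem t)) [RHS](bigID (mem s)) /=.
  rewrite [X in _ + X]big1 ?addr0 => [|i /tx->]; last by rewrite scale0r.
  rewrite [X in _ = _ + X]big1 ?addr0 => [|i /sx->]; last by rewrite scale0r.
  rewrite -big_filter -[RHS]big_filter; apply: perm_big.
  apply: uniq_perm; rewrite ?filter_uniq // => i.
  by rewrite !mem_filter andbC.
have [|||f fP] := linear_graph (G := fun x y =>
    exists s, [/\ uniq s, forall i, i \notin s -> coef x i = 0 & y = S s x]).
- by move=> x; have [s us sx] := free_supp x; exists (S s x), s.
- move=> a x y _ _ [s [us sx ->]] [t [ut ty ->]].
  have uu := undup_uniq (s ++ t); set u := undup _ in uu.
  have ux i : i \notin u -> coef x i = 0.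
    by rewrite mem_undup mem_cat negb_or => /andP[/sx].
  have uy i : i \notin u -> coef y i = 0.
    by rewrite mem_undup mem_cat negb_or => /andP[_ /ty].
  exists u; split=> // [i iu|]; first by rewrite coefP ux // uy // mulr0 addr0.
  rewrite (SE s u) // (SE t u) // /S scaler_sumr -big_split.
  apply: eq_bigr => i _.
  by rewrite coefP scalerDl scalerA.
- by move=> _ [s [_ _ ->]]; rewrite /S big1 // => i _; rewrite coef0 scale0r.
exists f => i; have [s [us sx ->]] := fP (basis_vec i).
rewrite (SE s [:: i]) // ?/S ?big_seq1 ?coef_basis_vec ?eqxx ?scale1r // => j.
by rewrite inE coef_basis_vec => /negPf->.
Qed.
End FreeModule.

(** * Submodules of free modules *)

(** Induction and maxima need a linear order whose strict part, which is
    [~~ le y x] by totality, is well founded.  The order properties are read off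
    from the unique least elements of sets with two or three elements. *)
Lemma wo_exists (I : eqType) : exists le : rel I,
  [/\ antisymmetric le, transitive le, total le &
      well_founded (fun x y => ~~ le y x)].
Proof.
have [le wo] := well_ordering_principle I; exists le.
have min (A : {pred I}) : (exists x, x \in A) ->
    exists z, z \in A /\ forall y, y \in A -> le z y.
  by move=> /wo[z [[Az zA] _]]; exists z.
have tot : total le.
  move=> x y; have [|z []] := min [pred z | (z == x) || (z == y)].
    by exists x; rewrite inE eqxx.
  rewrite inE => /orP[]/eqP-> zA; first by rewrite zA // inE eqxx orbT.
  by rewrite (zA x) ?orbT // inE eqxx.
have refl : reflexive le by move=> x; have := tot x x; rewrite orbb.
have anti : antisymmetric le.
  move=> x y /andP[xy yx].
  have [|z [[_ _] uz]] := wo [pred z | (z == x) || (z == y)].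
    by exists x; rewrite inE eqxx.
  have lw u : le u x -> le u y ->
      forall w, w \in [pred z | (z == x) || (z == y)] -> le u w.
    by move=> ux uy w; rewrite inE => /orP[]/eqP->.
  by rewrite -(uz x) ?(uz y) //; split; rewrite ?inE ?eqxx ?orbT //; apply: lw.
split; [exact: anti | | exact: tot | ].
  move=> y x z xy yz.
  have [|w []] := min [pred w | [|| w == x, w == y | w == z]].
    by exists x; rewrite inE eqxx.
  rewrite inE => /or3P[]/eqP-> wA.
  - by apply: wA; rewrite inE eqxx !orbT.
  - have yx : le y x by apply: wA; rewrite inE eqxx.
    by rewrite (anti x y) // xy.
  - have zy : le z y by apply: wA; rewrite inE eqxx !orbT.
    by rewrite -(anti y z) // yz.
move=> x; apply: contrapT => nx.
have [|z [/asboolP nz zA]] :=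
  min [pred z | `[< ~ Acc (fun x y => ~~ le y x) z >]].
  by exists x; apply/asboolP.
apply: nz; constructor=> y; rewrite -implybF => /implyP yz.
by apply: contrapT => ny; apply/notF/yz/zA/asboolP.
Qed.

Section Submodules.
Variables (R : pzRingType) (I : choiceType).
Local Notation F := (free_mod R I).

Lemma dsum0 (g : I -> R) i : coef (0 : F) i * g i = coef (0 : F) i.
Proof. by rewrite coef0 mul0r. Qed.

Lemma dsumD (g : I -> R) a (x y : F) :
  (forall i, coef x i * g i = coef x i) ->
  (forall i, coef y i * g i = coef y i) ->
  forall i, coef (a *: x + y) i * g i = coef (a *: x + y) i.
Proof. by move=> xg yg i; rewrite coefP mulrDl -mulrA xg yg. Qed.

(** For idempotents g, this is the direct sum of the left ideals R (g i). *)
Definition dsum (g : I -> R) : submodClosed F :=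
  mk_submod (dsum0 g) (dsumD (g := g)).

Lemma dsumP g x : reflect (forall i, coef x i * g i = coef x i) (x \in dsum g).
Proof. exact: mk_submodP. Qed.

Variables (le : rel I).
Hypothesis le_anti : antisymmetric le.
Hypothesis le_trans : transitive le.
Hypothesis le_total : total le.
Hypothesis le_wf : well_founded (fun x y => ~~ le y x).

Definition below (x : F) t := forall i, coef x i != 0 -> le i t.

Lemma exists_top (x : F) : x <> 0 -> exists2 t, coef x t != 0 & below x t.
Proof.
move=> x0; have [s us sx] := free_supp x.
have le_refl i : le i i by have := le_total i i; rewrite orbb.
have mx (u : seq I) : u != [::] ->
    exists2 t, t \in u & forall i, i \in u -> le i t.
  elim: u => // a [_ _|b u /(_ isT)[t tu ut] _].
    by exists a; rewrite ?inE // => i; rewrite inE => /eqP->.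
  have [at_|ta] := orP (le_total a t).
    exists t => [|i]; first by rewrite inE tu orbT.
    by rewrite inE => /predU1P[->|/ut].
  exists a; first exact: mem_head.
  move=> i; rewrite inE => /predU1P[->//|/ut it]; exact: le_trans ta.
have [|t] := mx [seq i <- s | coef x i != 0].
  apply/eqP => s0; apply: x0; apply: free_ext => i; rewrite coef0.
  have [si|/sx//] := boolP (i \in s); apply/eqP; apply/negPn/negP => xi.
  suff : i \in [seq i <- s | coef x i != 0] by rewrite s0.
  by rewrite mem_filter xi.
rewrite mem_filter => /andP[xt _] ut; exists t => // i xi; apply: ut.
by rewrite mem_filter xi; apply: contraNT xi => /sx->.
Qed.

Variable N : submodClosed F.

Lemma top_ideal0 t : exists x, [/\ x \in N, below x t & 0 = coef x t].
Proof.
exists 0; split; rewrite ?coef0 ?rpred0 //.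
by move=> i; rewrite coef0 eqxx.
Qed.

Lemma belowD a x y t : below x t -> below y t -> below (a *: x + y) t.
Proof.
move=> bx by_ i; rewrite coefP.
have [/bx//|/negPn/eqP->] := boolP (coef x i != 0).
by rewrite mulr0 add0r => /by_.
Qed.

Lemma top_idealD t (a : R) (r s : R^o) :
  (exists x, [/\ x \in N, below x t & r = coef x t]) ->
  (exists x, [/\ x \in N, below x t & s = coef x t]) ->
  exists x, [/\ x \in N, below x t & a *: r + s = coef x t].
Proof.
move=> [x [Nx bx ->]] [y [Ny by_ ->]]; exists (a *: x + y); split.
- by rewrite rpredD // rpredZ.
- exact: (@belowD a x y t bx by_).
- by rewrite coefP.
Qed.

(** The analogue, for a well-ordered basis, of an ideal of leading
    coefficients. *)
Definition top_ideal t : submodClosed (R^o) :=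
  mk_submod (top_ideal0 t) (@top_idealD t).

Lemma top_idealP t (r : R^o) :
  reflect (exists x, [/\ x \in N, below x t & r = coef x t])
    (r \in top_ideal t).
Proof. exact: mk_submodP. Qed.

(** Kaplansky's argument.  The hypotheses say that right multiplication by c t
    is a bijection from the ideal of the x with x * g t = x onto [top_ideal t].
    Since m t is bounded by t and has c t as coefficient at t, the map that
    sends the basis vector t to m t is triangular: it is injective by looking at
    the top coefficient, and onto N by well-founded induction on the top index,
    each step cancelling the top coefficient. *)
Lemma dsum_iso (c g : I -> R) :
  (forall t, c t \in top_ideal t) ->
  (forall t a, a * g t = a -> a * c t = 0 -> a = 0) ->
  (forall t r, r \in top_ideal t -> exists2 a, a * g t = a & r = a * c t) ->
  isomorphic (submodule (dsum g)) (submodule N).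
Proof.
move=> cN cI cS.
have /choice[m mP] : forall t,
    exists x, [/\ x \in N, below x t & c t = coef x t].
  by move=> t; apply/top_idealP.
have [psi psiE] := free_lift m.
have psiS x s : uniq s -> (forall i, i \notin s -> coef x i = 0) ->
    psi x = \sum_(i <- s) coef x i *: m i.
  move=> us sx; rewrite {1}(free_sum us sx) linear_sum; apply: eq_bigr => i _.
  by rewrite linearZ psiE.
have psiN x : psi x \in N.
  have [s us sx] := free_supp x; rewrite (psiS x s) // rpred_sum // => i _.
  by rewrite rpredZ //; case: (mP i).
pose f : {linear submodule (dsum g) -> submodule N} :=
  corestr psiN \o incl (dsum g).
have fE x : incl N (f x) = psi (incl _ x) by [].
suff [fI fS] : injective f /\ forall y, exists x, f x = y.
  by exists f; have [h [fh hf]] := inj_surj_inv fI fS; exists h.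
split.
  apply: linear_inj => x fx0; apply: incl_inj; rewrite linear0.
  have {fx0} : psi (incl _ x) = 0 by rewrite -fE fx0 linear0.
  have /dsumP : incl _ x \in dsum g by exact: incl_in.
  move: (incl _ x) => {}x xg px0; apply: contrapT => /exists_top[t xt bx].
  (* At the top index t of x only the term of m t survives. *)
  case/negP: (xt); apply/eqP/(cI t) => //.
  have [s us sx] := free_supp x.
  have st : t \in s by apply: contraNT xt => /sx->.
  rewrite -(coef0 R t) -px0 (psiS x s) // coef_sum.
  rewrite (bigD1_seq t) //= big1 ?addr0.
    by case: (mP t) => _ _ ->; rewrite coefZ.
  move=> i it; rewrite coefZ; have [_ bm _] := mP i.
  have [xi|/negPn/eqP->] := boolP (coef x i != 0); last exact: mul0r.
  have [mt|/negPn/eqP->] := boolP (coef (m i) t != 0); last exact: mulr0.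
  by case/eqP: it; apply: le_anti; rewrite bx // bm.
move=> y.
suff [x xg xy] : exists2 x, x \in dsum g & psi x = incl N y.
  have [z zx] := inclP xg; exists z; apply: incl_inj.
  by rewrite fE -zx.
have : incl N y \in N by exact: incl_in.
move: (incl N y) => {}y Ny.
have [->|/exists_top[t _ bt]] := pselect (y = 0).
  by exists 0; rewrite ?linear0 // rpred0.
elim/(well_founded_ind le_wf): t y Ny bt => t IH y Ny bt.
have [a ag ac] : exists2 a, a * g t = a & coef y t = a * c t.
  by apply: cS; apply/top_idealP; exists y.
have [Nm bm cm] := mP t.
pose z := (- a) *: m t + y.
have Nz : z \in N by rewrite rpredD // rpredZ.
have bz : below z t by exact: (@belowD (- a) _ _ _ bm bt).
have z0 : coef z t = 0 by rewrite coefP -cm ac mulNr addNr.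
have yE : y = a *: m t + z by rewrite /z scaleNr addrA subrr add0r.
suff [x xg xz] : exists2 x, x \in dsum g & psi x = z.
  exists (a *: basis_vec R t + x); last by rewrite linearP psiE xz -yE.
  rewrite rpredD //; apply/dsumP => i; rewrite coefZ coef_basis_vec.
  by case: eqP => [->|_]; rewrite ?mulr1 // !mulr0 mul0r.
have [->|/exists_top[u zu bu]] := pselect (z = 0).
  by exists 0; rewrite ?linear0 // rpred0.
apply: (IH u) => //; apply/negP => tu.
case/eqP: (zu); rewrite -z0; congr coef; apply: le_anti; rewrite tu.
by rewrite bz.
Qed.
End Submodules.

Section Cyclic.
Variable R : pzRingType.

Lemma fixed_ideal0 (e : R) : (0 : R^o) * e = 0.
Proof. exact: mul0r. Qed.

Lemma fixed_idealD (e : R) (a : R) (x y : R^o) :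
  x * e = x -> y * e = y -> (a *: x + y) * e = a *: x + y.
Proof. by move=> xe ye; rewrite mulrDl -mulrA xe ye. Qed.

(** For e idempotent, this is the left ideal R e. *)
Definition fixed_ideal (e : R) : submodClosed (R^o) :=
  mk_submod (fixed_ideal0 e) (fixed_idealD (e := e)).

Lemma fixed_idealP (e : R) (x : R^o) :
  reflect (x * e = x) (x \in fixed_ideal e).
Proof. exact: mk_submodP. Qed.

(** Let u : J -> R e and v : R e -> J with v u = 1.  Every map out of R e is a
    right multiplication, determined by the image of e: so v is multiplication
    by c = v(e) and u v is multiplication by g = u(c).  Since u v is an
    idempotent map with image isomorphic to J through v, g is an idempotent of
    R e, and multiplication by c maps R g bijectively onto J. *)
Lemma vss_cyclic (e : R) (J : submodClosed (R^o)) :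
  e * e = e -> virtually_semisimple (submodule (fixed_ideal e)) ->
  {subset J <= fixed_ideal e} ->
  exists c g : R, [/\ (c : R^o) \in J, g * g = g, g * e = g,
    forall a, a * g = a -> a * c = 0 -> a = 0 &
    forall r : R^o, r \in J -> exists2 a, a * g = a & r = a * c].
Proof.
move=> ee /vssP vE JE.
have JE' x : incl J x \in fixed_ideal e by apply/JE/incl_in.
have [|u [v uv]] := vE (submodule J).
  exists (corestr JE') => x y /(congr1 (incl _)).
  by rewrite !corestrE => /incl_inj.
have /inclP[e1 e1E] : (e : R^o) \in fixed_ideal e by apply/fixed_idealP.
pose c := incl J (v e1); pose g : R := incl _ (u (v e1)).
have lE (x : submodule (fixed_ideal e)) : x = (incl _ x : R) *: e1.
  apply: incl_inj; rewrite linearZ -e1E; apply/esym.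
  exact/fixed_idealP/incl_in.
have ge : g * e = g by apply/fixed_idealP/incl_in.
have vE' (x : submodule (fixed_ideal e)) : incl J (v x) = (incl _ x : R) * c.
  by rewrite {1}(lE x) !linearZ.
have uE (y : submodule J) : (incl _ (u y) : R) = incl _ (u y) * g.
  by rewrite -[in LHS](uv y) {1}(lE (u y)) !linearZ.
exists c, g; split=> //; first exact: incl_in.
- by rewrite -uE.
- move=> a ag ac; have /inclP[x xE] : (a : R^o) \in fixed_ideal e.
    by apply/fixed_idealP; rewrite -ag -mulrA ge.
  have vx : v x = 0 by apply: incl_inj; rewrite vE' linear0 -xE.
  have uvx : incl _ (u (v x)) = (incl _ x : R) * g.
    by rewrite {1}(lE x) !linearZ.
  by rewrite -ag xE -uvx vx !linear0.
- move=> r /inclP[y ->]; exists (incl _ (u y)); first by rewrite -uE.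
  by rewrite -vE' uv.
Qed.
End Cyclic.

Section DirectSums.
Variables (R : pzRingType) (I : choiceType).
Local Notation F := (free_mod R I).

(** An element of N bounded by t has its coefficient at t in R (e t), so
    [top_ideal] lies in an ideal to which [vss_cyclic] applies. *)
Lemma sub_dsum_iso (e : I -> R) (N : submodClosed F) :
  (forall i, e i * e i = e i) ->
  (forall i, virtually_semisimple (submodule (fixed_ideal (e i)))) ->
  {subset N <= dsum e} ->
  exists g, [/\ forall i, g i * g i = g i, forall i, g i * e i = g i &
    isomorphic (submodule (dsum g)) (submodule N)].
Proof.
move=> ee ve Ne; have [le [le_anti le_trans le_total le_wf]] := wo_exists I.
have Je t : {subset top_ideal le N t <= fixed_ideal (e t)}.
  move=> _ /top_idealP[x [/Ne/dsumP xe _ ->]]; exact/fixed_idealP/xe.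
have /choice[c /choice[g cg]] := fun t => vss_cyclic (ee t) (ve t) (Je t).
exists g; split=> [t|t|]; try by case: (cg t).
apply: (@dsum_iso R I le le_anti le_trans le_total le_wf N c g) => t;
  by case: (cg t).
Qed.

Lemma coef_mulr (g : I -> R) :
  exists p : {linear F -> F}, forall x i, coef (p x) i = coef x i * g i.
Proof.
apply: (linear_graph (G := fun x y : F => forall i, coef y i = coef x i * g i)).
- move=> x; have [s _ sx] := free_supp x.
  by apply: (@free_build _ _ _ s) => i /sx->; rewrite mul0r.
- by move=> a x y x' y' xx yy i; rewrite !coefP xx yy mulrDl mulrA.
- by move=> y y0; apply: free_ext => i; rewrite y0 !coef0 mul0r.
Qed.

(** From [g i * e i = g i] one gets R (g i) inside R (e i), and right
    multiplication by g i projects the latter onto the former. *)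
Lemma dsum_retract (e g : I -> R) :
  (forall i, g i * g i = g i) -> (forall i, g i * e i = g i) ->
  retract (submodule (dsum g)) (submodule (dsum e)).
Proof.
move=> gg ge; have [p pE] := coef_mulr g.
have ie x : incl (dsum g) x \in dsum e.
  have /dsumP xg := incl_in x.
  by apply/dsumP => i; rewrite -xg -mulrA ge.
have pg x : (p \o incl (dsum e)) x \in dsum g.
  by apply/dsumP => i; rewrite pE -mulrA gg.
exists (corestr ie), (corestr pg) => x; apply: incl_inj.
have /dsumP xg := incl_in x.
by rewrite corestrE; apply: free_ext => i; rewrite pE.
Qed.

Lemma vss_dsum (e : I -> R) :
  (forall i, e i * e i = e i) ->
  (forall i, virtually_semisimple (submodule (fixed_ideal (e i)))) ->
  virtually_semisimple (submodule (dsum e)).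
Proof.
move=> ee ve; apply/vssP => K [k kI].
pose f : {linear K -> F} := incl (dsum e) \o k.
have fI : injective f by apply: inj_comp kI; exact: incl_inj.
have [|g [gg ge gN]] := sub_dsum_iso ee ve (N := image_sub f).
  by move=> _ /image_subP[x ->]; exact: incl_in.
apply: retract_trans (dsum_retract gg ge).
apply/isomorphic_retract/(isomorphic_trans (image_sub_iso fI)).
exact: isomorphic_sym.
Qed.

Lemma dsum1_iso : isomorphic (submodule (dsum (fun _ : I => 1))) F.
Proof. by apply: full_iso => x; apply/dsumP => i; rewrite mulr1. Qed.

Lemma fixed_ideal1_iso : isomorphic (submodule (fixed_ideal (1 : R))) R^o.
Proof. by apply: full_iso => x; apply/fixed_idealP; rewrite mulr1. Qed.

Lemma embeds_free_dsum K : left_virtually_semisimple R -> embeds K F ->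
  exists g : I -> R,
    (forall i, g i * g i = g i) /\ isomorphic K (submodule (dsum g)).
Proof.
move=> vR [k kI].
have v1 (i : I) : virtually_semisimple (submodule (fixed_ideal (1 : R))).
  exact/(vss_isomorphic _ vR)/isomorphic_sym/fixed_ideal1_iso.
have [|x _|g [gg _ gN]] := sub_dsum_iso _ v1 (N := image_sub k).
- by move=> i; rewrite mulr1.
- by apply/dsumP => i; rewrite mulr1.
exists g; split=> //; apply: (isomorphic_trans (image_sub_iso kI)).
exact: isomorphic_sym.
Qed.

Lemma vss_free : left_virtually_semisimple R -> virtually_semisimple F.
Proof.
move=> vR; apply: (vss_isomorphic dsum1_iso); apply: vss_dsum => i.
  by rewrite mulr1.
exact/(vss_isomorphic _ vR)/isomorphic_sym/fixed_ideal1_iso.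
Qed.

Lemma cvss_free : left_completely_virtually_semisimple R ->
  completely_virtually_semisimple F.
Proof.
move=> cR; apply/cvssP => K KF.
have [g [gg Kg]] := embeds_free_dsum (cvss_vss cR) KF.
apply: (vss_isomorphic (isomorphic_sym Kg)); exact: vss_dsum.
Qed.
End DirectSums.

(** * Free and projective modules over virtually semisimple rings *)

Section Projective.
Variable R : pzRingType.
Implicit Types K M N P : lmodType R.

Lemma free_module_iso M : free_module M ->
  exists I : choiceType, isomorphic (free_mod R I) M.
Proof.
move=> [B [Bli Bgen]]; pose I : choiceType := {x : M | x \in B}.
exists I; have [f fE] := free_lift (fun i : I => \val i).
have [||g [fg gf]] := inj_surj_inv (f := f); last by exists f, g.
  apply: linear_inj => x fx0; apply: free_ext => i; rewrite coef0.
  have [s us sx] := free_supp x.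
  (* Linear independence in M quantifies over coefficients indexed by all of M,
     so the coefficients of x are extended by 0 outside the basis. *)
  pose a y := if (insub y : option I) is Some i then coef x i else 0.
  have aE j : a (\val j) = coef x j by rewrite /a valK.
  have [si|/sx//] := boolP (i \in s).
  rewrite -aE; apply: (Bli [seq \val j | j <- s]).
  - by rewrite map_inj_uniq //; exact: val_inj.
  - by move=> _ /mapP[j _ ->]; exact: valP.
  - rewrite big_map -[RHS]fx0 [in RHS](free_sum us sx) linear_sum.
    by apply: eq_bigr => j _; rewrite linearZ fE aE.
  - exact: map_f.
move=> y; have [s [a [sB ->]]] := Bgen y.
suff /image_subP[x xE] : \sum_(y <- s) a y *: y \in image_sub f by exists x.
rewrite big_seq rpred_sum // => z /sB Bz; rewrite rpredZ //.
by apply/image_subP; exists (basis_vec R (Sub z Bz : I)); rewrite fE.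
Qed.

Lemma regular_free : free_module (R^o : lmodType R).
Proof.
exists (fun x : R^o => x == 1); split.
  move=> s a us sB; case: s us sB => [//|x [|y s]] us sB.
    have /eqP-> : x == 1 by apply: (sB x); rewrite inE.
    by rewrite big_seq1 -[_ *: _]/(_ * _) mulr1 => a1 y; rewrite inE => /eqP->.
  have /eqP x1 : x == 1 by apply: (sB x); rewrite inE eqxx.
  have /eqP y1 : y == 1 by apply: (sB y); rewrite !inE eqxx orbT.
  by move: us; rewrite x1 y1 /= inE eqxx.
move=> x; exists [:: 1], (fun=> x); split; first by move=> y; rewrite inE.
by rewrite big_seq1 -[_ *: _]/(_ * _) mulr1.
Qed.

Lemma regular_projective : projective (R^o : lmodType R).
Proof.
move=> M N g f gS; have [m gm] := gS (f 1).
have lh : linear (fun x : R^o => (x : R) *: m).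
  by move=> a x y; rewrite scalerDl scalerA.
exists (mk_linear lh) => x.
by rewrite linearZ gm -linearZ -[_ *: _]/(_ * _) mulr1.
Qed.

Lemma projective_free (I : choiceType) : projective (free_mod R I).
Proof.
move=> M N g f gS; have /choice[m gm] := fun i => gS (f (basis_vec R i)).
have [h hE] := free_lift m; exists h => x.
have [s us sx] := free_supp x; rewrite (free_sum us sx) !linear_sum.
by apply: eq_bigr => i _; rewrite !linearZ hE gm.
Qed.

Lemma projective_retract K P : retract K P -> projective P -> projective K.
Proof.
move=> [i [p ip]] pP M N g f gS; have [h hE] := pP M N g (f \o p) gS.
by exists (h \o i) => x; rewrite /= hE /= ip.
Qed.

Lemma projective_retract_free P : projective P -> retract P (free_mod R P).
Proof.
move=> pP; have [f fE] := free_lift (id : P -> P).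
have [|h hE] := pP _ _ f idfun; last by exists h, f.
by move=> y; exists (basis_vec R y).
Qed.

(** Left virtually semisimple rings are left hereditary. *)
Lemma embeds_projective K P : left_virtually_semisimple R ->
  projective P -> embeds K P -> projective K.
Proof.
move=> vR pP KP.
have KF := embeds_trans KP (retract_embeds (projective_retract_free pP)).
have [g [gg Kg]] := embeds_free_dsum vR KF.
apply: projective_retract (@projective_free P).
apply: (retract_trans (isomorphic_retract Kg)).
apply: retract_trans (isomorphic_retract (dsum1_iso _ _)).
by apply: dsum_retract => // i; rewrite mulr1.
Qed.

Lemma cvss_projective P : left_completely_virtually_semisimple R ->
  projective P -> completely_virtually_semisimple P.
Proof.
move=> cR pP; apply: (cvss_embeds _ (@cvss_free R P cR)).
exact/retract_embeds/projective_retract_free/pP.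
Qed.

Lemma vss_free_module M : left_virtually_semisimple R ->
  free_module M -> virtually_semisimple M.
Proof.
move=> vR /free_module_iso[I FM].
exact: (vss_isomorphic FM (@vss_free R I vR)).
Qed.
End Projective.

(** * Semisimple modules *)

Section Semisimple.
Variables (R : pzRingType) (M : lmodType R).

Lemma simple_sub (S Q : submodClosed M) : simple_module (submodule S) ->
  (forall x, x \in S -> x \in Q -> x = 0) \/ {subset S <= Q}.
Proof.
move=> [_ simS].
have H0 : incl S 0 \in Q by rewrite linear0 rpred0.
have HD a (x y : submodule S) : incl S x \in Q -> incl S y \in Q ->
    incl S (a *: x + y) \in Q.
  by move=> Qx Qy; rewrite linearP rpredD // rpredZ.
have [Q0|QS] := simS (mk_submod (P := fun x => incl S x \in Q) H0 HD);
  [left | right].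
  by move=> x /inclP[y ->] Qy; rewrite (Q0 y) ?linear0 //; apply/mk_submodP.
by move=> x /inclP[y ->]; move/mk_submodP: (QS y).
Qed.

Definition sumsub_pred (A B : submodClosed M) x :=
  exists2 y, y \in A & x - y \in B.

Lemma sumsub0 (A B : submodClosed M) : sumsub_pred A B 0.
Proof. by exists 0; rewrite ?subr0 rpred0. Qed.

Lemma sumsubD (A B : submodClosed M) a x y :
  sumsub_pred A B x -> sumsub_pred A B y -> sumsub_pred A B (a *: x + y).
Proof.
move=> [u Au Bu] [v Av Bv]; exists (a *: u + v).
  by rewrite rpredD // rpredZ.
by rewrite opprD addrACA -scalerBr rpredD // rpredZ.
Qed.

Definition sumsub (A B : submodClosed M) :=
  mk_submod (sumsub0 A B) (@sumsubD A B).

Lemma sumsubP (A B : submodClosed M) x :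
  reflect (exists2 y, y \in A & x - y \in B) (x \in sumsub A B).
Proof. exact: mk_submodP. Qed.

Lemma exists_max_disjoint (A : submodClosed M) : exists2 D : submodClosed M,
  (forall x, x \in A -> x \in D -> x = 0) &
  forall E : submodClosed M, {subset D <= E} ->
    (forall x, x \in A -> x \in E -> x = 0) -> {subset E <= D}.
Proof.
pose T := {D : submodClosed M | forall x, x \in A -> x \in D -> x = 0}.
pose Z := kernel_sub (idfun : {linear M -> M}).
have Z0 x : x \in A -> x \in Z -> x = 0 by move=> _ /kernel_subP.
pose le (D E : T) := `[< {subset sval D <= sval E} >].
have [|||D maxD] := @ZL_preorder T (exist _ Z Z0) le.
- by move=> D; apply/asboolP.
- by move=> D E C /asboolP DE /asboolP EC; apply/asboolP => x /DE/EC.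
  (* The disjunct x = 0 makes U a submodule even when the chain is empty. *)
- move=> C totC; pose U x := x = 0 \/ exists2 D : T, C D & x \in sval D.
  have UD a x y : U x -> U y -> U (a *: x + y).
    move=> [->|[D CD Dx]] [->|[E CE Ey]].
    + by left; rewrite scaler0 addr0.
    + by right; exists E; rewrite // scaler0 add0r.
    + by right; exists D; rewrite // addr0 rpredZ.
    + right; have [/asboolP DE|/asboolP ED] := totC D E CD CE.
        by exists E; rewrite // rpredD // rpredZ // DE.
      by exists D; rewrite // rpredD // ?rpredZ // ED.
  have dU x : x \in A -> x \in mk_submod (or_introl erefl : U 0) UD -> x = 0.
    by move=> Ax /mk_submodP[//|[D _ Dx]]; exact: (svalP D).
  exists (exist _ (mk_submod (or_introl erefl : U 0) UD) dU) => D CD.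
  by apply/asboolP => x Dx; apply/mk_submodP; right; exists D.
exists (sval D); first exact: (svalP D).
move=> E DE dE; have lDE : le D (exist _ E dE) by exact/asboolP.
by move/asboolP: (maxD _ lDE).
Qed.

(** Let D be maximal among the submodules that meet A trivially.  A simple
    submodule S not contained in A + D would meet it trivially, so S + D would
    still meet A trivially; by maximality S would be contained in D.  So A + D
    contains all simple submodules, hence M. *)
Lemma semisimple_complement (A : submodClosed M) : semisimple_module M ->
  exists2 D : submodClosed M, (forall x, x \in A -> x \in D -> x = 0) &
    forall x, exists2 y, y \in A & x - y \in D.
Proof.
move=> ssM; have [D AD maxD] := exists_max_disjoint A; exists D => // x.
apply/sumsubP; have [s [simS ->]] := ssM x.
rewrite big_seq rpred_sum // => y /simS[S [sS Sy]].
have [SQ|] := simple_sub (sumsub A D) sS; last exact.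
have sub : {subset D <= sumsub S D}.
  by move=> z Dz; apply/sumsubP; exists 0; rewrite ?subr0 // rpred0.
have dis z : z \in A -> z \in sumsub S D -> z = 0.
  move=> Az /sumsubP[w Sw Dzw].
  have w0 : w = 0.
    apply: SQ => //; apply/sumsubP; exists z => //.
    by rewrite -submodN opprB.
  by apply: AD => //; rewrite w0 subr0 in Dzw.
have Dy : y \in D.
  apply: (maxD _ sub dis); apply/sumsubP; exists y => //.
  by rewrite subrr rpred0.
by apply/sumsubP; exists 0; rewrite ?subr0 // rpred0.
Qed.

Lemma semisimple_cvss :
  semisimple_module M -> completely_virtually_semisimple M.
Proof.
move=> ssM; apply/cvssP => N [j jI]; apply/vssP => K [k kI].
pose f : {linear K -> M} := j \o k.
have fI : injective f by exact: inj_comp.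
have [D dis dec] := semisimple_complement (image_sub f) ssM.
have [||p fp] := @split_of_complement R K M f D.
- by move=> x; have [_ /image_subP[y ->]] := dec x; exists y.
- move=> y Dy; apply: fI; rewrite linear0; apply: dis => //.
  exact: image_sub_in.
by exists k, (p \o j) => x; exact: fp.
Qed.
End Semisimple.

(** * Direct sums of two modules *)

Section Pairs.
Variable R : pzRingType.
Implicit Types K N P : lmodType R.

(** K maps onto its projection P' in P, which is projective, so K is the direct
    sum of P' and of the kernel N' of that map, on which the projection to N is
    injective. *)
Lemma pair_embeds K N P : (forall L, embeds L P -> projective L) ->
  embeds K (N * P)%type ->
  exists N' P', [/\ embeds N' N, embeds P' P & isomorphic (N' * P')%type K].
Proof.
move=> prP [k kI].
have l1 : linear (fun x => (k x).1) by move=> a x y; rewrite linearP.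
have l2 : linear (fun x => (k x).2) by move=> a x y; rewrite linearP.
pose k1 := mk_linear l1; pose k2 := mk_linear l2.
have k12 x : k1 x = 0 -> k2 x = 0 -> x = 0.
  move=> x1 x2; apply: kI; rewrite linear0 [LHS]surjective_pairing.
  by rewrite [X in (X, _)]x1 [X in (_, X)]x2.
have prI := prP _ (sub_embeds (image_sub k2)).
have [s sE] := prI _ _ (to_image_sub k2) idfun (@to_image_sub_surj _ _ _ k2).
exists (submodule (kernel_sub k2)), (submodule (image_sub k2)); split.
- exists (k1 \o incl (kernel_sub k2)); apply: linear_inj => x x1.
  apply: incl_inj; rewrite linear0; apply: k12 => //.
  exact/kernel_subP/incl_in.
- exact: sub_embeds.
have k2s y : k2 (s y) = incl _ y.
  by rewrite -(corestrE (@image_sub_in _ _ _ k2)) sE.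
have lf : linear (fun z : submodule (kernel_sub k2) *
    submodule (image_sub k2) => incl _ z.1 + s z.2).
  by move=> a x y; rewrite !linearP scalerDr addrACA.
exists (mk_linear lf).
have k2z z : k2 (mk_linear lf z) = incl _ z.2.
  rewrite [mk_linear lf z]/= linearD k2s.
  by have /kernel_subP -> := incl_in z.1; rewrite add0r.
have [||g [fg gf]] := inj_surj_inv (f := mk_linear lf); last by exists g.
  apply: linear_inj => -[x y] /= xy0.
  have y0 : y = 0.
    by apply: incl_inj; rewrite -(k2z (x, y)) [mk_linear _ _]xy0 !linear0.
  move: xy0; rewrite y0 linear0 addr0 => x0.
  by congr pair; apply: incl_inj; rewrite linear0.
move=> y; have /inclP[x xE] : y - s (to_image_sub k2 y) \in kernel_sub k2.
  by apply/kernel_subP; rewrite linearB k2s subrr.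
by exists (x, to_image_sub k2 y); rewrite -[LHS]/(incl _ x + s _) -xE subrK.
Qed.

Lemma pair_retract N N' P P' : retract N' N -> retract P' P ->
  retract (N' * P')%type (N * P)%type.
Proof.
move=> [i [p ip]] [j [q jq]].
have lu : linear (fun z : N' * P' => (i z.1, j z.2)).
  by move=> a x y; congr pair; rewrite !linearP.
have lv : linear (fun z : N * P => (p z.1, q z.2)).
  by move=> a x y; congr pair; rewrite !linearP.
by exists (mk_linear lu), (mk_linear lv) => -[x y] /=; rewrite ip jq.
Qed.

Lemma vss_pair N P : (forall L, embeds L P -> projective L) ->
  virtually_semisimple N -> virtually_semisimple P ->
  virtually_semisimple (N * P)%type.
Proof.
move=> prP /vssP vN /vssP vP; apply/vssP => K.
move=> /(pair_embeds prP)[N' [P' [NN PP iK]]].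
apply: (retract_trans (isomorphic_retract (isomorphic_sym iK))).
by apply: pair_retract; [exact: vN | exact: vP].
Qed.

Lemma cvss_pair N P : (forall L, embeds L P -> projective L) ->
  completely_virtually_semisimple N -> completely_virtually_semisimple P ->
  completely_virtually_semisimple (N * P)%type.
Proof.
move=> prP /cvssP cN /cvssP cP; apply/cvssP => K.
move=> /(pair_embeds prP)[N' [P' [NN PP iK]]].
apply: (vss_isomorphic iK); apply: vss_pair; [|exact: cN | exact: cP].
by move=> L /embeds_trans/(_ PP)/prP.
Qed.
End Pairs.

(** * Finite products of rings *)

Section Products.
Variables (I : finType) (R : I -> pzRingType).
Local Notation RP := (ring_prod R).
Implicit Types A B N : submodClosed (RP^o).

(** The type annotations make this a map of modules, over the projection of
    rings. *)
Definition proj i (x : RP^o) : (R i)^o := (x : RP) i.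

Lemma projP a x y i :
  proj i (a *: x + y) = (proj i a : R i) *: proj i x + proj i y.
Proof.
by rewrite /proj -[a *: x]/(rp_mul a x) -[_ + _]/(rp_add _ _) !ffunE.
Qed.

Lemma proj0 i : proj i 0 = 0.
Proof. by rewrite /proj -[0]/(rp_zero R) ffunE. Qed.

Lemma proj_sum i (F : I -> RP^o) : proj i (\sum_j F j) = \sum_j proj i (F j).
Proof.
apply: (big_morph (proj i)) => [u v|]; last exact: proj0.
by rewrite /proj -[u + v]/(rp_add u v) ffunE.
Qed.

Lemma proj_ext x y : (forall i, proj i x = proj i y) -> x = y.
Proof. by move=> xy; apply/ffunP => i; exact: xy. Qed.

Lemma proj_build (f : forall i, (R i)^o) : exists x, forall i, proj i x = f i.
Proof. by exists [ffun i => f i : R i] => i; rewrite /proj ffunE. Qed.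

Lemma proj_surj i (r : (R i)^o) : exists x, proj i x = r.
Proof.
(* The family is dependent, so r is cast along i = j. *)
exists [ffun j => if eqP : reflect (i = j) (i == j) is ReflectT ij
   then ecast k (R k) ij (r : R i) else 0 : R j].
by rewrite /proj ffunE; case: eqP => // ii; rewrite eq_axiomK.
Qed.

Lemma proj_ideal0 N i : exists2 x, x \in N & proj i x = 0.
Proof. by exists 0; [exact: rpred0 | exact: proj0]. Qed.

Lemma proj_idealD N i (a : R i) (r s : (R i)^o) :
  (exists2 x, x \in N & proj i x = r) ->
  (exists2 x, x \in N & proj i x = s) ->
  exists2 x, x \in N & proj i x = a *: r + s.
Proof.
move=> [x Nx <-] [y Ny <-]; have [b bE] := proj_surj a.
exists (b *: x + y); first by rewrite rpredD // rpredZ.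
by rewrite projP bE.
Qed.

Definition proj_ideal N i : submodClosed ((R i)^o) :=
  mk_submod (proj_ideal0 N i) (@proj_idealD N i).

Lemma proj_idealP N i (r : (R i)^o) :
  reflect (exists2 x, x \in N & proj i x = r) (r \in proj_ideal N i).
Proof. exact: mk_submodP. Qed.

Lemma proj_in N i (x : submodule N) : proj i (incl N x) \in proj_ideal N i.
Proof. by apply/proj_idealP; exists (incl N x) => //; exact: incl_in. Qed.

Definition to_proj N i (x : submodule N) : submodule (proj_ideal N i) :=
  Sub (proj i (incl N x)) (proj_in i x).

Lemma to_projE N i x : incl _ (to_proj i x) = proj i (incl N x).
Proof. by []. Qed.

Lemma to_projP N i a (x y : submodule N) :
  to_proj i (a *: x + y) = (proj i a : R i) *: to_proj i x + to_proj i y.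
Proof. by apply: incl_inj; rewrite linearP !to_projE linearP projP. Qed.

(** A left ideal contains the e_i y for y in it, where e_i is the idempotent of
    the factor i; so its elements can be assembled from elements of it that
    have the right component at a single index. *)
Lemma in_of_proj N x : (forall i, proj i x \in proj_ideal N i) -> x \in N.
Proof.
move=> xN.
have /choice[y yN] : forall i, exists y, y \in N /\ proj i y = proj i x.
  by move=> i; have /proj_idealP[y Ny yi] := xN i; exists y.
pose e i : RP := [ffun j => (i == j)%:R : R j].
suff -> : x = \sum_i e i *: y i.
  by rewrite rpred_sum // => i _; rewrite rpredZ //; case: (yN i).
have eE i j : proj j (e i *: y i) = ((i == j)%:R : R j) *: proj j (y i).
  by rewrite -[e i *: y i]addr0 projP proj0 addr0 {1}/proj ffunE.
apply: proj_ext => j; rewrite proj_sum (bigD1 j) //= big1 => [|i /negPf ij].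
  by rewrite addr0 eE eqxx scale1r; case: (yN j).
by rewrite eE ij scale0r.
Qed.

Lemma prod_map A B
    (f : forall i,
      {linear submodule (proj_ideal A i) -> submodule (proj_ideal B i)}) :
  exists g : {linear submodule A -> submodule B}, forall x i,
    to_proj i (g x) = f i (to_proj i x).
Proof.
apply: (linear_graph
  (G := fun x y => forall i, to_proj i y = f i (to_proj i x))).
- move=> x; have [y yE] := proj_build (fun i => incl _ (f i (to_proj i x))).
  have /inclP[z zE] : y \in B.
    by apply: in_of_proj => i; rewrite yE; exact: incl_in.
  by exists z => i; apply: incl_inj; rewrite to_projE -zE yE.
- by move=> a x y x' y' xx yy i; rewrite !to_projP linearP xx yy.
- move=> y y0; apply: incl_inj; apply: proj_ext => i; rewrite -to_projE y0.
  have -> : to_proj i (0 : submodule A) = 0.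
    by apply: incl_inj; rewrite to_projE !linear0 proj0.
  by rewrite !linear0 proj0.
Qed.

Lemma proj_idealS A B i :
  {subset A <= B} -> {subset proj_ideal A i <= proj_ideal B i}.
Proof.
by move=> AB _ /proj_idealP[x /AB Bx <-]; apply/proj_idealP; exists x.
Qed.

(** A submodule A of N is again determined by its projections, which are
    retracts of those of N; the retractions are assembled by [prod_map]. *)
Lemma vss_of_proj N :
  (forall i, virtually_semisimple (submodule (proj_ideal N i))) ->
  virtually_semisimple (submodule N).
Proof.
move=> vN; apply/vssP => K [k kI].
pose f : {linear K -> RP^o} := incl N \o k; pose A := image_sub f.
have fI : injective f by apply: inj_comp kI; exact: incl_inj.
have AN : {subset A <= N} by move=> _ /image_subP[x ->]; exact: incl_in.
have rN i : retract (submodule (proj_ideal A i)) (submodule (proj_ideal N i)).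
  have /vssP := vN i; apply.
  have sN x : incl (proj_ideal A i) x \in proj_ideal N i.
    by apply: proj_idealS AN _ _; exact: incl_in.
  exists (corestr sN) => x y /(congr1 (incl _)).
  by rewrite !corestrE => /incl_inj.
have [u [v uv]] : exists
    (u : forall i,
      {linear submodule (proj_ideal A i) -> submodule (proj_ideal N i)})
    (v : forall i,
      {linear submodule (proj_ideal N i) -> submodule (proj_ideal A i)}),
    forall i, cancel (u i) (v i).
  exists (fun i => projT1 (cid (rN i))).
  exists (fun i => projT1 (cid (projT2 (cid (rN i))))).
  by move=> i; exact: (projT2 (cid (projT2 (cid (rN i))))).
have [g gE] := prod_map u; have [h hE] := prod_map v.
apply: (retract_trans (isomorphic_retract (image_sub_iso fI))).
exists g, h => x; apply/incl_inj/proj_ext => i.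
have hgx : to_proj i (h (g x)) = to_proj i x by rewrite hE gE; exact: uv.
exact: (congr1 (incl _) hgx).
Qed.

Lemma ring_prod_vss :
  (forall i, left_virtually_semisimple (R i)) -> left_virtually_semisimple RP.
Proof.
move=> vR; apply: (vss_isomorphic (fixed_ideal1_iso RP)).
apply: vss_of_proj => i.
apply: vss_isomorphic (vR i); apply/isomorphic_sym/full_iso => r.
have [x <-] := proj_surj r; apply/proj_idealP; exists x => //.
by apply/fixed_idealP; rewrite mulr1.
Qed.

Lemma ring_prod_cvss :
  (forall i, left_completely_virtually_semisimple (R i)) ->
  left_completely_virtually_semisimple RP.
Proof. by move=> cR N; apply: vss_of_proj => i; exact: cR. Qed.
End Products.

(** * Equivalences of module categories *)

Section Equivalence.
Variables (R S : pzRingType) (F : module_functor R S) (G : module_functor S R).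

Section NaturalIso.
Hypothesis GF : comp_natural_iso_id F G.

Lemma fmap_retract (K N : lmodType R) : retract K N -> retract (F K) (F N).
Proof.
move=> [i [p ip]]; exists (fmap F i), (fmap F p) => x.
rewrite -[LHS](fmap_comp p i) -[RHS](@fmap_id _ _ F).
by apply: fmap_ext => z; exact: ip.
Qed.

Lemma fmap_bij (M N : lmodType R) (f : {linear M -> N}) :
  bijective f -> bijective (fmap F f).
Proof.
move=> /bij_linear_inv[g [fg gf]]; exists (fmap F g) => x.
- rewrite -[LHS](fmap_comp g f) -[RHS](@fmap_id _ _ F); exact: fmap_ext.
- rewrite -[LHS](fmap_comp f g) -[RHS](@fmap_id _ _ F); exact: fmap_ext.
Qed.

Lemma fmap2_inj (M N : lmodType R) (f : {linear M -> N}) :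
  injective f -> injective (fmap G (fmap F f)).
Proof.
case: GF => eta [etaB etaN] fI x y.
have [e eK Ke] := etaB M; rewrite -(Ke x) -(Ke y) -!etaN.
by move=> /(bij_inj (etaB N))/fI->.
Qed.

Lemma fmap2_surj (M N : lmodType R) (f : {linear M -> N}) :
  (forall y, exists x, f x = y) -> forall y, exists x, fmap G (fmap F f) x = y.
Proof.
case: GF => eta [etaB etaN] fS y.
have [e eK Ke] := etaB N; have [x xE] := fS (e y).
by exists (eta M x); rewrite -etaN xE Ke.
Qed.

Lemma fmap2_reflect_surj (M N : lmodType R) (f : {linear M -> N}) :
  (forall y, exists x, fmap G (fmap F f) x = y) -> forall y, exists x, f x = y.
Proof.
case: GF => eta [etaB etaN] fS y; have [e eK Ke] := etaB M.
have [x xE] := fS (eta N y); exists (e x).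
by apply: (bij_inj (etaB N)); rewrite etaN Ke.
Qed.

Lemma fmap2_iso (M : lmodType R) : isomorphic M (G (F M)).
Proof. by case: GF => eta [etaB _]; exists (eta M). Qed.

Lemma fmap2_faithful (M N : lmodType R) (f g : {linear M -> N}) :
  fmap G (fmap F f) =1 fmap G (fmap F g) -> f =1 g.
Proof.
case: GF => eta [etaB etaN] fg x.
by apply: (bij_inj (etaB N)); rewrite !etaN.
Qed.
End NaturalIso.
End Equivalence.

(** Injectivity is cancellability on the left: the inclusion of the kernel of
    F f and the zero map agree after composition with F f, so G maps them to
    maps that agree after composition with G (F f), which is injective like f.
    As G is faithful, they are equal. *)
Lemma fmap_inj (R S : pzRingType) (F : module_functor R S)
    (G : module_functor S R) (GF : comp_natural_iso_id F G)
    (FG : comp_natural_iso_id G F)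
    (M N : lmodType R) (f : {linear M -> N}) :
  injective f -> injective (fmap F f).
Proof.
move=> fI; apply: linear_inj => x fx0.
pose K := kernel_sub (fmap F f).
have lz : linear (fun _ : submodule K => 0 : F M).
  by move=> a u v; rewrite scaler0 addr0.
pose z := mk_linear lz.
have kz : fmap F f \o incl K =1 fmap F f \o z.
  move=> u; rewrite [RHS](linear0 (fmap F f)).
  exact/(kernel_subP (fmap F f))/incl_in.
have Gkz : fmap G (incl K) =1 fmap G z.
  move=> u; apply: (fmap2_inj GF fI).
  rewrite -[LHS](fmap_comp (fmap F f) (incl K)) -[RHS](fmap_comp (fmap F f) z).
  exact: (@fmap_ext _ _ G _ _ (fmap F f \o incl K) (fmap F f \o z)).
have /inclP[u ->] : x \in K by exact/kernel_subP.
by rewrite (fmap2_faithful FG (f := incl K) (g := z) (fmap_ext Gkz)).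
Qed.

Lemma fmap_embeds (R S : pzRingType) (F : module_functor R S)
    (G : module_functor S R) (GF : comp_natural_iso_id F G)
    (FG : comp_natural_iso_id G F)
    (K N : lmodType R) : embeds K N -> embeds (F K) (F N).
Proof. by case=> k kI; exists (fmap F k); exact: (fmap_inj GF FG). Qed.

(** Factor F f through the inclusion i of its image.  As G (F f) is surjective
    like f, so is G i; it is also injective by [fmap_inj], hence invertible, and
    so is i.  This avoids characterizing surjections as epimorphisms, which
    would call for quotient modules. *)
Lemma fmap_surj (R S : pzRingType) (F : module_functor R S)
    (G : module_functor S R) (GF : comp_natural_iso_id F G)
    (FG : comp_natural_iso_id G F)
    (M N : lmodType R) (f : {linear M -> N}) :
  (forall y, exists x, f x = y) -> forall y, exists x, fmap F f x = y.
Proof.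
move=> fS; pose L := image_sub (fmap F f); pose i := incl L.
have GiS y : exists x, fmap G i x = y.
  have [x <-] := fmap2_surj GF fS y.
  exists (fmap G (to_image_sub (fmap F f)) x).
  rewrite -[LHS](fmap_comp i (to_image_sub (fmap F f))).
  exact: fmap_ext.
have [j [ij ji]] := inj_surj_inv (fmap_inj FG GF (@incl_inj _ _ L)) GiS.
have iS : forall y, exists x, i x = y.
  apply: (fmap2_reflect_surj FG) => y.
  have [h hK Kh] := fmap_bij F (f := fmap G i) (Bijective ij ji).
  by exists (h y).
move=> y; have [x <-] := iS y; have /image_subP[w wE] := incl_in x.
by exists w; rewrite /i wE.
Qed.

(** To lift f : F P -> N through g : M -> N, lift G f composed with the unit
    P -> G (F P) through G g, and apply F.  The result lifts f only up to the
    automorphism of F P made of the images of the two natural isomorphisms,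
    which need not satisfy the triangle identity; composing on the right with
    eps at F P and then with the inverse t of F (eta P) corrects this. *)
Lemma fmap_projective (R S : pzRingType) (F : module_functor R S)
    (G : module_functor S R) (GF : comp_natural_iso_id F G)
    (FG : comp_natural_iso_id G F)
    (P : lmodType R) : projective P -> projective (F P).
Proof.
move=> pP M N g f gS.
have [eta [etaB _]] := GF; have [eps [epsB epsN]] := FG.
have [h hE] := pP _ _ (fmap G g) (fmap G f \o eta P) (fmap_surj FG GF gS).
have [e [_ eK]] := bij_linear_inv (epsB M).
have [t [_ tK]] := bij_linear_inv (fmap_bij F (etaB P)).
exists (e \o fmap F h \o t \o eps (F P)) => x /=.
apply: (bij_inj (epsB N)); rewrite epsN eK.
rewrite -[LHS](fmap_comp (fmap G g) h) (fmap_ext (g := fmap G f \o eta P)) //.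
by rewrite (fmap_comp (fmap G f) (eta P)) /= tK epsN.
Qed.

Lemma morita_equivalent_sym (R S : pzRingType) :
  morita_equivalent R S -> morita_equivalent S R.
Proof. by move=> [F [G [GF FG]]]; exists G, F. Qed.

(** For K in N in S, the images under G lie in the projective R-module G S, so
    G K is a retract of G N; applying F brings this back. *)
Lemma morita_cvss (R S : pzRingType) : morita_equivalent R S ->
  left_completely_virtually_semisimple R ->
  left_completely_virtually_semisimple S.
Proof.
move=> [F [G [GF FG]]] cR; apply/cvssP => N NS; apply/vssP => K KN.
have pGS : projective (G S^o) := fmap_projective FG GF (@regular_projective S).
have /cvssP cGS := cvss_projective cR pGS.
have /vssP vGN := cGS _ (fmap_embeds FG GF NS).
have rGK := vGN _ (fmap_embeds FG GF KN).
apply: (retract_trans (isomorphic_retract (fmap2_iso FG K))).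
apply: (retract_trans (fmap_retract F rGK)).
exact/isomorphic_retract/isomorphic_sym/fmap2_iso.
Qed.

Theorem proposition3p3 :
  (* (i) *)
  ((forall R : pzRingType,
      left_virtually_semisimple R <->
      (forall M : lmodType R, free_module M -> virtually_semisimple M)) /\
   (forall R : pzRingType,
      left_completely_virtually_semisimple R <->
      (forall P : lmodType R,
         projective P -> completely_virtually_semisimple P))) /\
  (* (ii) *)
  (forall R S : pzRingType, morita_equivalent R S ->
     (left_completely_virtually_semisimple R <->
      left_completely_virtually_semisimple S)) /\
  (* (iii) *)
  ((forall (I : finType) (R : I -> pzRingType),
      (forall i : I, left_virtually_semisimple (R i)) ->
      left_virtually_semisimple (ring_prod R)) /\
   (forall (I : finType) (R : I -> pzRingType),
      (forall i : I, left_completely_virtually_semisimple (R i)) ->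
      left_completely_virtually_semisimple (ring_prod R))) /\
  (* (iv) *)
  (forall R : pzRingType, left_completely_virtually_semisimple R ->
     forall N P : lmodType R,
       semisimple_module N -> projective P -> socle_eq0 P ->
       completely_virtually_semisimple (N * P)%type).
Proof.
split; [split => R; split | split; [| split; [split |]]].
- by move=> vR M; exact: vss_free_module.
- by move=> vM; apply: vM; exact: regular_free.
- by move=> cR P; exact: cvss_projective.
- by move=> cP; apply: cP; exact: regular_projective.
- move=> R S RS; split; apply: morita_cvss => //.
  exact: morita_equivalent_sym.
- exact: ring_prod_vss.
- exact: ring_prod_cvss.
- move=> R cR N P ssN pP _; apply: cvss_pair.
  + by move=> L; apply: embeds_projective (cvss_vss cR) pP.
  + exact: semisimple_cvss.
  + exact: cvss_projective.
Qed.
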